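(* Let $K$ be a nonempty compact Hausdorff space. If $K$ has a regular tunnel of cardinality $\kappa$, then there exists a nontrivial short exact sequence of Banach spaces $$0\longrightarrow C(K)\longrightarrow Z\longrightarrow c_0(\kappa)\longrightarrow 0 .$$
   Context: For open $U,V$ in a Hausdorff space $X$, $U<V$ means $\overline U\subseteq V$, and $U\le V$ means $U<V$ or $U=V$. A chain (of open sets) is a family of open subsets of $X$ linearly ordered by $\le$. A tunnel in $X$ is a chain $\mathscr U$ of open subsets of $X$ such that $\bigcup\{\partial U:U\in\mathscr U\}$ is dense in $X$. An open set is regular if it equals the interior of its closure; a regular tunnel is a tunnel consisting of regular open sets. $C(K)$ is the Banach space of continuous functions $K\to\mathbb R$ with the sup norm. For a set $I$, $c_0(I)$ is the space of functions $f\colon I\to\mathbb R$ such that $\{i\in I:|f(i)|>\varepsilon\}$ is finite for every $\varepsilon>0$, with the sup norm. A short exact sequence $0\to Y\xrightarrow{\imath}Z\xrightarrow{\pi}X\to0$ of Banach spaces is a diagram of Banach spaces and bounded linear operators in which the kernel of each arrow equals the range of the preceding one. It is trivial if there is a bounded linear operator $\varpi\colon Z\to Y$ with $\varpi\circ\imath=\mathrm{Id}_Y$; otherwise it is nontrivial. *)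

(* Defs.v *)
From HB Require Import structures.
From mathcomp Require Import all_boot all_order all_algebra.
From mathcomp Require Import boolp classical_sets functions cardinality.
From mathcomp Require Import reals topology normedtype.

Set Implicit Arguments.
Unset Strict Implicit.
Unset Printing Implicit Defensive.

Import Order.TTheory GRing.Theory Num.Theory.
Import numFieldNormedType.Exports.

Local Open Scope classical_set_scope.
Local Open Scope ring_scope.

(** * Tunnels *)

Section tunnels.
Context {X : topologicalType}.
Implicit Types (U V W : set X) (F : set (set X)).

Definition open_lt U V : Prop := closure U `<=` V.

Definition open_le U V : Prop := open_lt U V \/ U = V.

(* [open_le] is a partial order on all sets, so on a family of open sets
   linearity amounts to comparability of any two members. *)
Lemma open_le_refl U : open_le U U. Proof. by right. Qed.

Lemma open_le_anti U V : open_le U V -> open_le V U -> U = V.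
Proof.
move=> [UV|//] [VU|//]; apply/seteqP; split=> x xP.
  exact/UV/subset_closure.
exact/VU/subset_closure.
Qed.

Lemma open_le_trans U V W : open_le U V -> open_le V W -> open_le U W.
Proof.
move=> [UV|->//] [VW|<-]; left => //.
by move=> x /UV/subset_closure; exact: VW.
Qed.

Definition open_chain F : Prop :=
  (forall U, F U -> open U) /\
  (forall U V, F U -> F V -> open_le U V \/ open_le V U).

Definition boundary U : set X := closure U `\` U°.

Definition tunnel F : Prop :=
  open_chain F /\ dense (\bigcup_(U in F) boundary U).

Definition regular_tunnel F : Prop :=
  tunnel F /\ (forall U, F U -> regopen U).

End tunnels.

(** * The sup norm *)

Section supnorm.
Context {R : realType} {T : Type}.
Implicit Types (f g : T -> R).

(* As [sup set0 = 0], this is 0 when [T] is empty. *)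
Definition supnorm f : R := sup (range (fun x => `|f x|)).

Definition bounded_function f : Prop := exists M, forall x, `|f x| <= M.

Lemma supnorm_ge f x : bounded_function f -> `|f x| <= supnorm f.
Proof.
move=> [M fM]; apply: ub_le_sup; last by exists x.
by exists M => _ [y _ <-].
Qed.

Lemma supnorm_le f M : 0 <= M -> (forall x, `|f x| <= M) -> supnorm f <= M.
Proof.
move=> M0 fM; have [r0|/set0P r0] := eqVneq (range (fun x => `|f x|)) set0.
  by rewrite /supnorm r0 sup0.
by apply: ge_sup => // _ [y _ <-].
Qed.

Lemma supnorm_ge0 f : bounded_function f -> 0 <= supnorm f.
Proof.
move=> bf; have [r0|/set0P[_ [x _ _]]] := eqVneq (range (fun x => `|f x|)) set0.
  by rewrite /supnorm r0 sup0.
exact: le_trans (normr_ge0 _) (supnorm_ge x bf).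
Qed.

Lemma supnormD f g : bounded_function f -> bounded_function g ->
  supnorm (f + g) <= supnorm f + supnorm g.
Proof.
move=> bf bg; apply: supnorm_le; first by rewrite addr_ge0 ?supnorm_ge0.
move=> x; rewrite (le_trans (ler_normD _ _))//.
by rewrite lerD ?supnorm_ge.
Qed.

Let supnormZ_le (l : R) f : bounded_function f ->
  supnorm (l *: f) <= `|l| * supnorm f.
Proof.
move=> bf; apply: supnorm_le; first by rewrite mulr_ge0 ?supnorm_ge0.
by move=> x; rewrite normrM ler_wpM2l ?supnorm_ge.
Qed.

Let bounded_functionZ (l : R) f : bounded_function f -> bounded_function (l *: f).
Proof.
by move=> [M fM]; exists (`|l| * M) => x; rewrite normrM ler_wpM2l.
Qed.

Lemma supnormZ (l : R) f : bounded_function f ->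
  supnorm (l *: f) = `|l| * supnorm f.
Proof.
move=> bf; apply/eqP; rewrite eq_le supnormZ_le//=.
have [->|l0] := eqVneq l 0.
  by rewrite normr0 mul0r supnorm_ge0//; exact: bounded_functionZ.
rewrite -ler_pdivlMl ?normr_gt0// -normfV.
have {1}-> : f = l^-1 *: (l *: f) by rewrite scalerA mulVf// scale1r.
exact/supnormZ_le/bounded_functionZ.
Qed.

Lemma supnorm0_eq0 f : bounded_function f -> supnorm f = 0 -> f = 0.
Proof.
move=> bf f0; apply/funext => x; apply/eqP; rewrite -normr_le0 -f0.
exact: supnorm_ge.
Qed.

(* Completeness of a normed space [V] of functions [ev v : T -> R] that carries
   the sup norm and is closed under uniform limits. *)
Lemma supnorm_cauchy_cvg (V : normedModType R) (ev : {linear V -> (T -> R)}) :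
  (forall v, bounded_function (ev v)) ->
  (forall v, `|v| = supnorm (ev v)) ->
  (forall f, (forall e, 0 < e -> exists v, forall x, `|f x - ev v x| <= e) ->
     exists v, ev v = f) ->
  forall F : set_system V, ProperFilter F -> cauchy F -> cvg F.
Proof.
move=> bev normE uclosed F FF /cauchy_ballP Fc.
have evB v w x : `|ev v x - ev w x| <= `|v - w|.
  by rewrite normE; apply: le_trans (supnorm_ge x (bev _)); rewrite linearB.
have cvgx x : cvg ((fun v => ev v x) @ F).
  apply: cauchy_cvg; apply/cauchy_ballP => e e0.
  rewrite near_map2; have := Fc e e0; apply: filterS => -[v w] /=.
  by rewrite -!ball_normE /=; exact/le_lt_trans/evB.
pose g x : R := lim ((fun v => ev v x) @ F).
have gP e : 0 < e -> \forall v \near F, forall x, `|g x - ev v x| <= e.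
  move=> e0; have e20 : 0 < e / 2 by rewrite divr_gt0.
  near=> v => x; near F => w.
  rewrite (splitr e) (le_trans (ler_distD (ev w x) _ _))// lerD//.
    near: w; have /cvgrPdist_le := cvgx x; exact.
  rewrite distrC (le_trans (evB v w x))//.
  near: w; near: v; apply: nearP_dep.
  have := Fc _ e20; apply: filterS => -[v w]; rewrite -ball_normE /=; exact: ltW.
have [|v vg] := uclosed g.
  move=> e e0; have [v ?] := filter_ex (gP e e0); by exists v.
apply/cvg_ex; exists v; apply/cvgrPdist_le => e e0.
have := gP e e0; apply: filterS => w gw.
rewrite normE; apply: supnorm_le => [|x]; first exact: ltW.
by rewrite linearB vg; exact: gw.
Unshelve. all: by end_near. Qed.

End supnorm.

(** * The Banach space C(K) *)

Section continuous_functions.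
Context (R : realType) (K : topologicalType).

Definition continuous_pred : {pred K -> R} := fun f => `[< continuous f >].

Lemma continuous_pred_submod : submod_closed continuous_pred.
Proof.
split; first by apply/asboolP => x; exact: cvg_cst.
move=> a f g /asboolP cf /asboolP cg; apply/asboolP => x.
by apply: cvgD; [apply: cvgZr; exact: cf|exact: cg].
Qed.

HB.instance Definition _ := GRing.isSubmodClosed.Build R (K -> R)
  continuous_pred continuous_pred_submod.

(* The compactness proof is a parameter of the type because the sup norm is a
   norm on continuous functions only when these are bounded. *)
Record Cspace (cK : compact [set: K]) := MkCspace {
  Cspace_fun :> K -> R ;
  _ : Cspace_fun \in continuous_pred }.

Section structure.
Variable cK : compact [set: K].

HB.instance Definition _ := [isSub for @Cspace_fun cK].
HB.instance Definition _ := [Choice of Cspace cK by <:].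
HB.instance Definition _ := [SubChoice_isSubLmodule of Cspace cK by <:].

Lemma Cspace_continuous (f : Cspace cK) : continuous f.
Proof. by case: f => f /= /asboolP. Qed.

Lemma Cspace_bounded (f : Cspace cK) : bounded_function f.
Proof.
have /compact_bounded [M [_ fM]] : compact (f @` [set: K]).
  apply: continuous_compact => //.
  exact/continuous_subspaceT/Cspace_continuous.
by exists (M + 1) => x; apply: (fM (M + 1)); rewrite ?ltrDl//; exists x.
Qed.

Definition Cspace_norm (f : Cspace cK) : R := supnorm f.

Let ler_normD (f g : Cspace cK) :
  Cspace_norm (f + g) <= Cspace_norm f + Cspace_norm g.
Proof. exact/supnormD/Cspace_bounded/Cspace_bounded. Qed.

Let normZ (l : R) (f : Cspace cK) : Cspace_norm (l *: f) = `|l| * Cspace_norm f.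
Proof. exact/supnormZ/Cspace_bounded. Qed.

Let norm0_eq0 (f : Cspace cK) : Cspace_norm f = 0 -> f = 0.
Proof. by move=> /(supnorm0_eq0 (Cspace_bounded f)) f0; exact/val_inj. Qed.

HB.instance Definition _ := Lmodule_isNormed.Build R (Cspace cK)
  ler_normD normZ norm0_eq0.

Lemma Cspace_normE (f : Cspace cK) : `|f| = supnorm f. Proof. by []. Qed.

Let complete (F : set_system (Cspace cK)) : ProperFilter F -> cauchy F -> cvg F.
Proof.
apply: (@supnorm_cauchy_cvg _ _ _ (val : {linear Cspace cK -> (K -> R)})) => //.
  exact: Cspace_bounded.
move=> f fu; suff cf : continuous f.
  by exists (MkCspace cK (asboolT cf)).
move=> x; apply/cvgrPdist_le => e e0; have e30 : 0 < e / 3 by rewrite divr_gt0.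
have [v fv] := fu _ e30.
have /cvgrPdist_le/(_ _ e30) := @Cspace_continuous v x.
apply: filterS => y vxy.
have -> : f x - f y = (f x - v x) + (v x - v y) + (v y - f y).
  by rewrite !addrA !subrK.
have -> : e = e / 3 + e / 3 + e / 3.
  by rewrite -mulr2n -mulrSr -[RHS]mulr_natr divfK ?pnatr_eq0.
rewrite (le_trans (Num.Theory.ler_normD _ _))// lerD//; last by rewrite distrC.
by rewrite (le_trans (Num.Theory.ler_normD _ _))// lerD.
Qed.

HB.instance Definition _ := Uniform_isComplete.Build (Cspace cK) complete.

End structure.
End continuous_functions.

(** * The Banach space c_0(I) *)

Section vanishing_functions.
Context (R : realType) (I : Type).

Definition c0_pred : {pred I -> R} :=
  fun f => `[< forall e, 0 < e -> finite_set [set i | e < `|f i|] >].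

Lemma c0_pred_submod : submod_closed c0_pred.
Proof.
split.
  apply/asboolP => e e0; apply: (sub_finite_set _ (finite_set0 _)) => i /=.
  by rewrite normr0 ltNge (ltW e0).
move=> a f g /asboolP cf /asboolP cg; apply/asboolP => e e0.
have a0 : 0 < `|a| + 1 by rewrite ltr_wpDl.
have e20 : 0 < e / 2 by rewrite divr_gt0.
have ea0 : 0 < e / 2 / (`|a| + 1) by rewrite divr_gt0.
have fin : finite_set
    ([set i | e / 2 / (`|a| + 1) < `|f i|] `|` [set i | e / 2 < `|g i|]).
  by rewrite finite_setU; split; [exact: cf|exact: cg].
apply: (sub_finite_set _ fin) => i /=; apply: contraPP => /not_orP[].
move=> /negP; rewrite -leNgt => fi /negP; rewrite -leNgt => gi.
apply/negP; rewrite -leNgt (splitr e) (le_trans (ler_normD _ _))// lerD//.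
rewrite normrM (@le_trans _ _ ((`|a| + 1) * `|f i|))//.
  by rewrite ler_wpM2r// lerDl.
by rewrite mulrC -ler_pdivlMr.
Qed.

HB.instance Definition _ := GRing.isSubmodClosed.Build R (I -> R)
  c0_pred c0_pred_submod.

Record c0 := MkC0 { c0_fun :> I -> R ; _ : c0_fun \in c0_pred }.

HB.instance Definition _ := [isSub for c0_fun].
HB.instance Definition _ := [Choice of c0 by <:].
HB.instance Definition _ := [SubChoice_isSubLmodule of c0 by <:].

Lemma c0_finite (f : c0) e : 0 < e -> finite_set [set i | e < `|f i|].
Proof. by case: f => f /= /asboolP; exact. Qed.

Lemma c0_bounded (f : c0) : bounded_function f.
Proof.
have /(finite_image (fun i => `|f i|)) /finite_seqP[s sE] :=
  c0_finite f (ltr01 : 0 < 1).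
exists (1 + \sum_(y <- s) `|y|) => i.
have [fi1|fi1] := leP `|f i| 1; first by rewrite (le_trans fi1)// lerDl sumr_ge0.
have : [set` s] `|f i| by rewrite -sE; exists i.
move=> /= fis; rewrite (big_rem _ fis)/= normr_id addrCA lerDl.
by rewrite addr_ge0 ?sumr_ge0.
Qed.

Definition c0_norm (f : c0) : R := supnorm f.

Let ler_normD (f g : c0) : c0_norm (f + g) <= c0_norm f + c0_norm g.
Proof. exact/supnormD/c0_bounded/c0_bounded. Qed.

Let normZ (l : R) (f : c0) : c0_norm (l *: f) = `|l| * c0_norm f.
Proof. exact/supnormZ/c0_bounded. Qed.

Let norm0_eq0 (f : c0) : c0_norm f = 0 -> f = 0.
Proof. by move=> /(supnorm0_eq0 (c0_bounded f)) f0; exact/val_inj. Qed.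

HB.instance Definition _ := Lmodule_isNormed.Build R c0
  ler_normD normZ norm0_eq0.

Lemma c0_normE (f : c0) : `|f| = supnorm f. Proof. by []. Qed.

Let complete (F : set_system c0) : ProperFilter F -> cauchy F -> cvg F.
Proof.
apply: (@supnorm_cauchy_cvg _ _ _ (val : {linear c0 -> (I -> R)})) => //.
  exact: c0_bounded.
move=> f fu; suff cf : forall e, 0 < e -> finite_set [set i | e < `|f i|].
  by exists (MkC0 (asboolT cf)).
move=> e e0; have e20 : 0 < e / 2 by rewrite divr_gt0.
have [v fv] := fu _ e20.
apply: (sub_finite_set _ (c0_finite v e20)) => i /=.
apply: contraTT; rewrite -!leNgt => vi.
rewrite -[f i](subrK (v i)) (splitr e) (le_trans (Num.Theory.ler_normD _ _))//.
exact: lerD.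
Qed.

HB.instance Definition _ := Uniform_isComplete.Build c0 complete.

End vanishing_functions.

(** * Short exact sequences of Banach spaces *)

Section short_exact_sequences.
Context {R : realType}.

Definition bounded_operator (V W : normedModType R) (f : {linear V -> W}) : Prop :=
  exists M : R, forall x, `|f x| <= M * `|x|.

Lemma bounded_operatorP (V W : normedModType R) (f : {linear V -> W}) :
  bounded_operator f <-> continuous f.
Proof.
rewrite -linear_bounded_continuous linear_boundedP; split=> [[M fM]|].
  near=> r => x; rewrite (le_trans (fM x))// ler_wpM2r//.
  by near: r; exact: nbhs_pinfty_ge (num_real M).
by move=> /pinfty_ex_gt0[M _ fM]; exists M.
Unshelve. all: by end_near. Qed.

Definition kernel (V W : normedModType R) (f : V -> W) : set V := f @^-1` [set 0].

Variables (Y Z X : completeNormedModType R).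

Record short_exact_sequence (i : {linear Y -> Z}) (p : {linear Z -> X}) : Prop :=
  ShortExactSequence {
    ses_bounded_i : bounded_operator i ;
    ses_bounded_p : bounded_operator p ;
    ses_exact_Y : kernel i = [set 0] ;
    ses_exact_Z : kernel p = range i ;
    ses_exact_X : [set: X] = range p }.

Definition trivial_sequence (i : {linear Y -> Z}) : Prop :=
  exists r : {linear Z -> Y}, bounded_operator r /\ r \o i = idfun.

End short_exact_sequences.

(* Main.v *)
(* Z consists of the pairs (f, c) of a bounded function f on K and an element c
   of c_0(kappa) such that f is continuous except that it jumps by c_U across
   the boundary of each U of the tunnel; these boundaries are disjoint. The
   projection (f, c) |-> c has kernel C(K). For finitely many members of the
   chain, subtracting Urysohn functions from the indicators makes their supports
   disjoint, so that finitely supported c lift without increase of norm, and all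
   c lift by approximation. A bounded retraction onto C(K) would yield lifts L_U
   of the unit vectors with sum_U |L_U(x)| bounded uniformly in x. But L_U jumps
   by 1 across the boundary of U, so |L_U| >= 1/3 on an open set close to any
   given boundary point; as the boundaries are dense, one finds n such functions
   that are all large at a common point, for every n. *)
Require Import Defs.
From HB Require Import structures.
From mathcomp Require Import all_boot all_order all_algebra.
From mathcomp Require Import boolp classical_sets functions cardinality.
From mathcomp Require Import reals topology normedtype sequences.
From mathcomp Require Import ring lra.

Set Implicit Arguments.
Unset Strict Implicit.
Unset Printing Implicit Defensive.

Import Order.TTheory GRing.Theory Num.Theory.
Import numFieldNormedType.Exports.

Local Open Scope classical_set_scope.
Local Open Scope ring_scope.
Local Open Scope card_scope.

(** The three-epsilon argument at a single point. The approximants may depend on [x], because the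
    continuity condition on the twisted sum changes from point to point. *)
Lemma uniform_limit_continuous_at (R : realType) (K : topologicalType)
    (f : K -> R) (x : K) :
  (forall e, 0 < e -> exists2 g : K -> R,
    {for x, continuous g} & forall y, `|f y - g y| <= e) ->
  {for x, continuous f}.
Proof.
move=> fu; apply/cvgrPdist_le => e e0.
have e30 : 0 < e / 3 by rewrite divr_gt0.
have [g /cvgrPdist_le/(_ _ e30) cg fg] := fu _ e30.
near=> y; have gxy : `|g x - g y| <= e / 3 by near: y.
have := fg x; have := fg y; move: gxy; rewrite !ler_norml; lra.
Unshelve. all: by end_near. Qed.

(** * The twisted sum as a Banach space *)

Section twisted_sum.
Context (R : realType) (K : topologicalType) (I : Type) (u : I -> set K).

Definition ind (A : set K) (y : K) : R := (y \in A)%:R.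

(** [None] labels the points off all boundaries. When the boundaries are pairwise disjoint, each
    point has exactly one label. *)
Definition on_boundary (x : K) (o : option I) : Prop :=
  if o is Some k then boundary (u k) x
  else forall k, ~ boundary (u k) x.

(* A pair (f, c) of a function on [K] and an element of c_0 is encoded as
   a single function on the disjoint union [K + I]; its norm is then the
   maximum of the two sup norms. *)
Definition jump (o : option I) (g : K + I -> R) (y : K) : R :=
  if o is Some k then g (inr k) * ind (u k) y else 0.

Definition unjumped (o : option I) (g : K + I -> R) (y : K) : R :=
  g (inl y) - jump o g y.

(** The condition removes only the jump at [x] itself: for [c] in c_0, the sum of all jumps
    [c_k * ind (u k)] over a chain need not converge. *)
Definition twist_pred : {pred K + I -> R} := fun g =>
  `[< [/\ bounded_function g, (g \o inr) \in @c0_pred R I &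
     forall x o, on_boundary x o -> {for x, continuous (unjumped o g)}] >].

Lemma ind_norm_le1 A y : `|ind A y| <= 1.
Proof. by rewrite /ind; case: (y \in A); rewrite ?normr1 ?normr0. Qed.

Lemma unjumpedD o (g h : K + I -> R) :
  unjumped o (g + h) = unjumped o g + unjumped o h.
Proof.
by apply/funext => y; rewrite /unjumped /jump !fctE; case: o => [k|]; ring.
Qed.

Lemma unjumpedZ o a (g : K + I -> R) : unjumped o (a *: g) = a *: unjumped o g.
Proof.
apply/funext => y; rewrite /unjumped /jump !fctE /GRing.scale /=.
by case: o => [k|]; ring.
Qed.

(** One [e] pays for the value at [y], the other for the coefficient of the jump. This lets the
    continuity condition pass to uniform limits. *)
Lemma unjumped_dist o (g h : K + I -> R) e :
  (forall t, `|g t - h t| <= e) ->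
  forall y, `|unjumped o g y - unjumped o h y| <= 2 * e.
Proof.
move=> gh y; have e0 := le_trans (normr_ge0 _) (gh (inl y)).
rewrite /unjumped /jump; case: o => [k|].
  have -> : g (inl y) - g (inr k) * ind (u k) y -
     (h (inl y) - h (inr k) * ind (u k) y) =
     (g (inl y) - h (inl y)) - (g (inr k) - h (inr k)) * ind (u k) y by ring.
  rewrite (le_trans (ler_normB _ _))// mulr_natl mulr2n lerD//.
  by rewrite normrM (le_trans (ler_piMr _ _)) ?ind_norm_le1.
by rewrite !subr0 (le_trans (gh _))// mulr_natl mulr2n lerDl.
Qed.

Lemma twist_pred_submod : submod_closed twist_pred.
Proof.
split.
  apply/asboolP; split; first by exists 0 => x; rewrite normr0.
  - rewrite -[_ \o _]/(0 : I -> R); exact: rpred0.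
  - move=> x o _; rewrite (_ : unjumped o 0 = cst 0); first exact: cvg_cst.
    by apply/funext => y; rewrite /unjumped /jump; case: o => [k|]/=;
      rewrite ?mul0r subr0.
move=> a f g /asboolP[[M fM] cf tf] /asboolP[[N gN] cg tg]; apply/asboolP; split.
- exists (`|a| * M + N) => x; rewrite (le_trans (ler_normD _ _))// lerD//.
  by rewrite normrM ler_wpM2l.
- by have := rpredD (rpredZ a cf) cg.
- move=> x o xo; rewrite unjumpedD unjumpedZ.
  by apply: cvgD; [apply: cvgZr; exact: tf|exact: tg].
Qed.

HB.instance Definition _ := GRing.isSubmodClosed.Build R (K + I -> R)
  twist_pred twist_pred_submod.

Record twist := MkTwist { twist_fun :> K + I -> R ; _ : twist_fun \in twist_pred }.

HB.instance Definition _ := [isSub for twist_fun].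
HB.instance Definition _ := [Choice of twist by <:].
HB.instance Definition _ := [SubChoice_isSubLmodule of twist by <:].

Lemma twist_bounded (z : twist) : bounded_function z.
Proof. by case: z => z /= /asboolP[]. Qed.

Lemma twist_c0 (z : twist) : (z \o inr) \in @c0_pred R I.
Proof. by case: z => z /= /asboolP[]. Qed.

Lemma twist_continuous (z : twist) x o :
  on_boundary x o -> {for x, continuous (unjumped o z)}.
Proof. by case: z => z /= /asboolP[_ _]; exact. Qed.

Definition twist_norm (z : twist) : R := supnorm z.

Let ler_normD (f g : twist) : twist_norm (f + g) <= twist_norm f + twist_norm g.
Proof. exact/supnormD/twist_bounded/twist_bounded. Qed.

Let normZ (l : R) (f : twist) : twist_norm (l *: f) = `|l| * twist_norm f.
Proof. exact/supnormZ/twist_bounded. Qed.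

Let norm0_eq0 (f : twist) : twist_norm f = 0 -> f = 0.
Proof. by move=> /(supnorm0_eq0 (twist_bounded f)) f0; exact/val_inj. Qed.

HB.instance Definition _ := Lmodule_isNormed.Build R twist
  ler_normD normZ norm0_eq0.

Let complete (F : set_system twist) : ProperFilter F -> cauchy F -> cvg F.
Proof.
apply: (@supnorm_cauchy_cvg _ _ _ (val : {linear twist -> (K + I -> R)})) => //.
  exact: twist_bounded.
move=> f fu; suff cf : f \in twist_pred by exists (MkTwist cf).
apply/asboolP; split.
- have [v fv] := fu _ (ltr01 : 0 < 1); have [M vM] := twist_bounded v.
  exists (1 + M) => t; rewrite -[f t](subrK (v t)).
  by rewrite (le_trans (Num.Theory.ler_normD _ _))// lerD.
- apply/asboolP => e e0; have e20 : 0 < e / 2 by rewrite divr_gt0.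
  have [v fv] := fu _ e20; have /asboolP/(_ _ e20) := twist_c0 v.
  apply: sub_finite_set => i /=.
  apply: contraTT; rewrite -!leNgt => vi.
  rewrite -[f _](subrK (v (inr i))) (splitr e).
  by rewrite (le_trans (Num.Theory.ler_normD _ _))// lerD.
- move=> x o xo; apply: uniform_limit_continuous_at => e e0.
  have e20 : 0 < e / 2 by rewrite divr_gt0.
  have [v fv] := fu _ e20; exists (unjumped o v); first exact: (twist_continuous xo).
  by move=> y; have := unjumped_dist o fv y; rewrite mulrC divfK ?pnatr_eq0.
Qed.

HB.instance Definition _ := Uniform_isComplete.Build twist complete.

Lemma twist_ge (z : twist) t : `|z t| <= `|z|.
Proof. exact/supnorm_ge/twist_bounded. Qed.

Lemma twist_le (z : twist) M : 0 <= M -> (forall t, `|z t| <= M) -> `|z| <= M.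
Proof. exact: supnorm_le. Qed.

Definition twist_proj (z : twist) : c0 R I := MkC0 (twist_c0 z).

Lemma twist_proj_linear : linear twist_proj.
Proof. by move=> a y z; apply/val_inj/funext. Qed.

HB.instance Definition _ := GRing.isLinear.Build R twist (c0 R I) _
  twist_proj twist_proj_linear.

(** * The copy of [C(K)] in the twisted sum *)

Section inclusion.
Variable cK : compact [set: K].

Let incl_fun (f : Cspace R cK) (t : K + I) : R := if t is inl y then f y else 0.

Let incl_subproof f : incl_fun f \in twist_pred.
Proof.
apply/asboolP; split.
- have [M fM] := Cspace_bounded f; exists `|M| => -[y|i] /=.
    exact: le_trans (fM y) (ler_norm _).
  by rewrite normr0.
- rewrite -[_ \o _]/(0 : I -> R); exact: rpred0.
- move=> x o _; rewrite (_ : unjumped _ _ = f); first exact: Cspace_continuous.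
  by apply/funext => y; rewrite /unjumped /jump; case: o => [k|]/=;
    rewrite ?mul0r subr0.
Qed.

Definition twist_incl (f : Cspace R cK) : twist := MkTwist (incl_subproof f).

Lemma twist_incl_linear : linear twist_incl.
Proof.
move=> a f g; apply/val_inj/funext => -[y|i]//=.
by rewrite !fctE /GRing.scale/= mulr0 addr0.
Qed.

HB.instance Definition _ := GRing.isLinear.Build R (Cspace R cK) twist _
  twist_incl twist_incl_linear.

(** If all coefficients vanish, there is no jump to remove, so the function part is continuous at
    every point, whatever its label. *)
Lemma twist_kernel_proj : kernel twist_proj = range twist_incl.
Proof.
apply/seteqP; split=> [z /= pz|_ [f _ <-]]; last exact/val_inj/funext.
have z0 k : z (inr k) = 0 by have /(congr1 (fun c : c0 R I => c k)) := pz.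
have cz : continuous (z \o inl).
  move=> x; suff [o xo] : exists o, on_boundary x o.
    suff -> : z \o inl = unjumped o z by exact: twist_continuous.
    apply/funext => y; rewrite /unjumped /jump; case: o {xo} => [k|]/=;
    by rewrite ?z0 ?mul0r subr0.
  have [[k xk]|xk] := pselect (exists k, boundary (u k) x); first by exists (Some k).
  by exists None => k xb; apply: xk; exists k.
exists (MkCspace cK (asboolT cz)) => //; apply/val_inj/funext => -[y|k]//=.
Qed.

End inclusion.
End twisted_sum.

(** * Boundaries, Urysohn functions and indicators *)

Lemma boundary_disjoint (K : topologicalType) (U V : set K) (x : K) :
  open U -> open V -> open_le U V \/ open_le V U -> U <> V ->
  boundary U x -> ~ boundary V x.
Proof.
rewrite /boundary => /interior_id-> /interior_id-> [] [UV|->]// _ [cU nU] [cV nV].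
- exact/nV/UV.
- exact/nU/UV.
Qed.

(** Regularity gives the second half: a neighbourhood of [x] inside [closure U] would put [x] in the
    interior of the closure, which is [U]. *)
Lemma regopen_boundary_split (K : topologicalType) (U W : set K) (x : K) :
  regopen U -> boundary U x -> nbhs x W ->
  (W `&` U !=set0) /\ (W `&` ~` closure U !=set0).
Proof.
move=> rU [cUx nUx] Wx; split; first by rewrite setIC; exact: cUx.
apply: contrapT => /set0P/negP; rewrite negbK => /eqP W0; apply: nUx.
have /interior_id -> : open U by rewrite -rU; exact: open_interior.
rewrite -rU.
apply: filterS Wx => y Wy; apply: contrapT => ncy.
by have : (W `&` ~` closure U) y by []; rewrite W0.
Qed.

Lemma urysohn01 (R : realType) (K : topologicalType) (A B : set K) :
  normal_space K -> closed A -> closed B -> A `&` B = set0 ->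
  exists f : K -> R, [/\ continuous f, forall y, 0 <= f y <= 1,
    forall y, A y -> f y = 0 & forall y, B y -> f y = 1].
Proof.
move=> nK cA cB AB0.
have /(@uniform_separatorP _ R)[f [cf f01 f0 f1]] :=
  normal_uniform_separator nK cA cB AB0.
exists f; split=> //.
- by move=> y; have := f01 _ (ex_intro2 _ _ y I erefl); rewrite /= in_itv.
- by move=> y Ay; apply: f0; exists y.
- by move=> y By; apply: f1; exists y.
Qed.
Lemma ind_continuous_at (R : realType) (K : topologicalType) (A : set K) (x : K) :
  ~ boundary A x -> {for x, continuous (ind R A)}.
Proof.
move=> xA; apply: cvg_near_cst; have [xiA|xiA] := pselect (A° x).
  rewrite [ind R A x]/ind mem_set; last exact: interior_subset.
  by move: xiA; apply: filterS => y Ay; rewrite /ind mem_set.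
have xcA : ~ closure A x by move=> xcA; apply: xA.
rewrite [ind R A x]/ind memNset; last by move=> /(@subset_closure _ A).
have : nbhs x (~` closure A).
  by apply: open_nbhs_nbhs; split => //; exact/closed_openC/closed_closure.
apply: filterS => y ycA; rewrite /ind memNset// => Ay.
exact/ycA/subset_closure.
Qed.

(** * Norm-preserving lifts of finitely supported vectors *)

Section finite_lift.
Context (R : realType) (K : topologicalType) (I : choiceType) (u : I -> set K).
Hypothesis nK : normal_space K.
Hypothesis ou : forall k, open (u k).
Hypothesis uinj : injective u.
Hypothesis chainu : forall j k, open_le (u j) (u k) \/ open_le (u k) (u j).

Lemma chain_lt j k : j != k -> Defs.open_lt (u j) (u k) \/ Defs.open_lt (u k) (u j).
Proof.
move=> /eqP jk; case: (chainu j k) => -[| /uinj]; [by left| |by right|];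
by move=> // /esym.
Qed.

(* Making each bump vanish on the smaller members of the chain keeps the
   supports of the bumps pairwise disjoint. *)
Lemma finite_lift (s : seq I) (c : I -> R) (M : R) :
  uniq s -> 0 <= M -> (forall k, k \in s -> `|c k| <= M) ->
  exists2 z : twist R u, `|z| <= M &
    forall k, z (inr k) = if k \in s then c k else 0.
Proof.
move=> us M0 cM.
pose smaller k := [set j | [/\ j \in s, j != k & Defs.open_lt (u j) (u k)]].
pose B k := \bigcup_(j in smaller k) closure (u j).
have clB k : closed (B k).
  apply: closed_bigcup => [|j _]; last exact: closed_closure.
  by apply: sub_finite_set (finite_seq s) => j [].
have BE k y j : j \in s -> j != k -> Defs.open_lt (u j) (u k) -> u j y -> B k y.
  by move=> js jk jlt uy; exists j => //; exact: subset_closure.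
have Bu k : ~` u k `&` B k = set0.
  by apply/seteqP; split=> // y /= [nuy [j [_ _ jk]]] /jk.
(* [g k] is 0 off [u k] and 1 on the closures of the smaller members, so [h k] vanishes on both. *)
have /choice[g gP] k :=
  urysohn01 R nK (open_closedC (ou k)) (clB k) (Bu k).
pose h k y := ind R (u k) y - g k y.
have h0 k y : ~ u k y -> h k y = 0.
  by move=> nuy; have [_ _ g0 _] := gP k; rewrite /h /ind memNset// g0// subrr.
have hB k y : u k y -> B k y -> h k y = 0.
  by move=> uy By; have [_ _ _ g1] := gP k; rewrite /h /ind mem_set// g1// subrr.
have h1 k y : `|h k y| <= 1.
  have [uy|nuy] := pselect (u k y); last by rewrite h0// normr0.
  have [_ /(_ y) + _ _] := gP k; rewrite /h /ind mem_set//= ler_norml; lra.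
have hdisj k j y : k \in s -> j \in s -> j != k -> h k y != 0 -> h j y = 0.
  move=> ks js jk hk; have [uj|] := pselect (u j y); last exact: h0.
  have uk : u k y by apply: contrapT => /h0 hk0; rewrite hk0 eqxx in hk.
  case: (chain_lt jk) => lt.
    by move: hk; rewrite hB ?eqxx//; apply: (BE k y j).
  by apply: hB => //; apply: (BE j y k) => //; rewrite eq_sym.
pose f y := \sum_(k <- s) c k * h k y.
have fM y : `|f y| <= M.
  have [/allP s0|] := boolP (all (fun k => h k y == 0) s).
    rewrite /f big_seq big1 ?normr0// => k ks.
    by have /eqP -> := s0 _ ks; rewrite mulr0.
  rewrite -has_predC => /hasP[k ks /= hk].
  rewrite /f (bigD1_seq k)//= big_seq_cond big1 ?addr0; last first.
    by move=> j /andP[js jk]; rewrite (hdisj k)// mulr0.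
  by rewrite normrM (le_trans (ler_piMr _ _)) ?cM.
pose z t := match t with inl y => f y | inr k => if k \in s then c k else 0 end.
have zM t : `|z t| <= M.
  by case: t => [y|k]//=; case: ifPn => [/cM//|_]; rewrite normr0.
suff zP : z \in twist_pred u by exists (MkTwist zP) => //; exact: twist_le.
apply/asboolP; split; first by exists M.
  apply/asboolP => e e0.
  apply: (sub_finite_set _ (finite_seq s)) => k /=.
  by case: ifPn => // _; rewrite normr0 ltNge (ltW e0).
move=> x o xo.
(* Removing the jump cancels the indicator of the set whose boundary contains [x]. The other
   indicators are continuous at [x], the boundaries being disjoint. *)
have -> : unjumped u o z =
    fun y => \sum_(k <- s) c k * ((Some k != o)%:R * ind R (u k) y - g k y).
  apply/funext => y; rewrite /unjumped /jump /= /f.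
  case: o xo => [k|] xo; last by rewrite subr0; apply: eq_bigr => j _; rewrite mul1r.
  case: ifPn => ks; last first.
    rewrite mul0r subr0; apply: eq_big_seq => j js.
    rewrite (_ : Some j != Some k) ?mul1r//.
    by apply: contraNN ks => /eqP[<-].
  rewrite (bigD1_seq k)//= [RHS](bigD1_seq k)//= eqxx /h.
  have -> : \sum_(j <- s | j != k) c j * (ind R (u j) y - g j y) =
    \sum_(j <- s | j != k) c j * ((Some j != Some k)%:R * ind R (u j) y - g j y).
    apply: eq_bigr => j jk; rewrite (_ : Some j != Some k) ?mul1r//.
  by rewrite mul0r; ring.
apply: (@cvg_big _ _ +%R) => [|k _]; first exact: add_continuous.
have gc : {for x, continuous (g k)} by have [gc _ _ _] := gP k; exact: gc.
apply: cvgMl_tmp; apply: cvgB; last exact: gc.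
have [_|ko] := eqVneq (Some k) o.
  by rewrite /= mul0r; under eq_fun do rewrite mul0r; exact: cvg_cst.
rewrite /=.
apply: cvgMl_tmp; apply: ind_continuous_at.
case: o xo ko => [j|] //= xj kj.
apply: (boundary_disjoint (ou j) (ou k)) xj => // /uinj jk.
by rewrite jk eqxx in kj.
Qed.
End finite_lift.

(** Successive approximation: each residual has at most half the norm of the previous one, so the
    lifts of the residuals form an absolutely convergent series, and its sum maps to [c]. *)
Lemma approx_lift_onto (R : realType) (V : completeNormedModType R)
    (W : normedModType R) (p : {linear V -> W}) :
  bounded_operator p ->
  (forall c, exists z, `|z| <= `|c| /\ `|c - p z| <= `|c| / 2) ->
  [set: W] = range p.
Proof.
move=> /bounded_operatorP pc /choice[l lP].
have l1 d : `|l d| <= `|d| by have [] := lP d.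
have l2 d : `|d - p (l d)| <= `|d| / 2 by have [] := lP d.
apply/seteqP; split=> // c _.
pose r n := iter n (fun d => d - p (l d)) c.
have rS n : r n.+1 = r n - p (l (r n)) by [].
have rn n : `|r n| <= geometric `|c| 2^-1 n.
  elim: n => [|n IH]; first by rewrite /geometric /= expr0 mulr1.
  rewrite rS (le_trans (l2 _))// /geometric /= exprSr mulrA.
  by rewrite ler_wpM2r// invr_ge0.
pose z : V^nat := fun n => l (r n).
have zc : cvgn (series z).
  apply: normed_cvg; apply: series_le_cvg (is_cvg_geometric_series _) => [n|n|n|].
  - exact: normr_ge0.
  - exact: (le_trans (normr_ge0 _) (rn n)).
  - exact: (le_trans (l1 _) (rn n)).
  - by rewrite ger0_norm ?invr_ge0// invf_lt1// ltr1n.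
have psz n : p (series z n) = c - r n.
  elim: n => [|n IH]; first by rewrite /series /= big_geq// linear0 subrr.
  by rewrite seriesSr linearD IH rS opprB addrCA addrC.
have r0 : r n @[n --> \oo] --> 0.
  apply/norm_cvg0P; apply: (@squeeze_cvgr _ _ _ _ (cst 0) (geometric `|c| 2^-1)).
  - by near=> n; rewrite rn /= normr_ge0.
  - exact: cvg_cst.
  - by apply: cvg_geometric; rewrite ger0_norm ?invr_ge0// invf_lt1// ltr1n.
exists (limn (series z)) => //.
have h1 : p (series z n) @[n --> \oo] --> p (limn (series z)).
  by apply: continuous_cvg => //; exact: pc.
have h2 : p (series z n) @[n --> \oo] --> c.
  under eq_fun do rewrite psz.
  suff : c - r n @[n --> \oo] --> c - 0 by rewrite subr0.
  by apply: cvgB => //; exact: cvg_cst.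
exact: cvg_unique h1 h2.
Unshelve. all: by end_near. Qed.

(** * Exactness of the sequence *)

Section tunnel.
Context (R : realType) (K : topologicalType) (I : choiceType) (u : I -> set K).
Hypothesis cK : compact [set: K].
Hypothesis hK : hausdorff_space K.
Hypothesis ou : forall k, open (u k).
Hypothesis uinj : injective u.
Hypothesis chainu : forall j k, open_le (u j) (u k) \/ open_le (u k) (u j).

Let nK : normal_space K := compact_normal hK cK.

Notation incl := (@twist_incl R K I u cK).
Notation proj := (@twist_proj R K I u).

Lemma twist_proj_le z : `|proj z| <= `|z|.
Proof. by apply: supnorm_le => // k; exact: twist_ge. Qed.

Lemma twist_incl_le f : `|incl f| <= `|f|.
Proof.
by apply: supnorm_le => // -[y|k] /=; rewrite ?normr0//;
  exact/supnorm_ge/Cspace_bounded.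
Qed.

(** Lifting only the finitely many coordinates of modulus above [|c| / 2] leaves an error of at most
    [|c| / 2]. The case [c = 0] is separate because finiteness requires a positive threshold. *)
Lemma twist_proj_onto : [set: c0 R I] = range proj.
Proof.
apply: approx_lift_onto.
  by exists 1 => z; rewrite mul1r twist_proj_le.
move=> c; have [->|c0] := eqVneq c 0.
  by exists 0; rewrite linear0 subr0 !normr0 mul0r; split.
have c20 : 0 < `|c| / 2 by rewrite divr_gt0// normr_gt0.
have /finite_seqP[s sE] := c0_finite c c20.
have [|||z zc zE] := @finite_lift R K I u nK ou uinj chainu (undup s) c `|c|.
- exact: undup_uniq.
- exact: normr_ge0.
- by move=> k _; exact/supnorm_ge/c0_bounded.
exists z; split=> //; apply: supnorm_le; first exact: ltW.
move=> k; rewrite -[_ k]/(c k - z (inr k)) zE mem_undup; case: ifPn => ks.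
  by rewrite subrr normr0 ltW.
rewrite subr0 leNgt; apply/negP => ck.
have : [set` s] k by rewrite -sE.
by rewrite /= (negbTE ks).
Qed.

Lemma twist_exact : @short_exact_sequence R _ _ _ incl proj.
Proof.
split.
- by exists 1 => f; rewrite mul1r twist_incl_le.
- by exists 1 => z; rewrite mul1r twist_proj_le.
- apply/seteqP; split=> [f /= f0|_ ->]; last exact: linear0.
  apply/val_inj/funext => y.
  by have /(congr1 (fun z : twist R u => z (inl y))) := f0.
- exact: twist_kernel_proj.
- exact: twist_proj_onto.
Qed.

(** * Nontriviality of the sequence *)

Hypothesis du : dense (\bigcup_k boundary (u k)).
Hypothesis ru : forall k, regopen (u k).
Hypothesis neK : [set: K] !=set0.

(* A lift of a unit vector jumps by 1 across the boundary of its open set, so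
   it is far from 0 on an open set close to that boundary. *)
Lemma big_on_open (k : I) (z : twist R u) (x : K) (W : set K) :
  z (inr k) = 1 -> boundary (u k) x -> open W -> W x ->
  exists W' : set K, [/\ open W', W' !=set0, W' `<=` W &
    forall y, W' y -> ~ boundary (u k) y /\ 3^-1 <= `|z (inl y)|].
Proof.
move=> zk xk oW Wx.
have Wn : nbhs x W by apply: open_nbhs_nbhs.
pose d := unjumped u (Some k) z.
have dc : {for x, continuous d} by exact: twist_continuous.
have dE y : d y = z (inl y) - ind R (u k) y by rewrite /d /unjumped /jump zk mul1r.
(* The function part of [z] is [d + 1] on [u k] and [d] off it, and [d] is continuous at [x]. If
   [d x] is at least -1/2, then nearby [d + 1 > 1/3], used inside [u k]; otherwise nearby
   [d < -1/3], used outside the closure. *)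
have [dx|dx] := leP (- 2^-1) (d x).
- have Nn : nbhs x (W `&` [set y | - (2 / 3) < d y]).
    apply: filterI => //; apply: (cvgr_gt _ dc); lra.
  exists ((W `&` [set y | - (2 / 3) < d y])° `&` u k); split.
  + exact: openI (open_interior _) (ou k).
  + by have [] := regopen_boundary_split (ru k) xk (nbhs_interior Nn).
  + by move=> y [/interior_subset[]].
  + move=> y [/interior_subset[_ /=]]; rewrite dE /ind => dy uy; split.
      by case; have /interior_id -> := ou k.
    move: dy; rewrite mem_set//= => dy; apply: le_trans (ler_norm _); lra.
- have Nn : nbhs x (W `&` [set y | d y < - 3^-1]).
    apply: filterI => //; apply: (cvgr_lt _ dc); lra.
  exists ((W `&` [set y | d y < - 3^-1])° `&` ~` closure (u k)); split.
  + exact: openI (open_interior _) (closed_openC (@closed_closure _ _)).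
  + by have [] := regopen_boundary_split (ru k) xk (nbhs_interior Nn).
  + by move=> y [/interior_subset[]].
  + move=> y [/interior_subset[_ /=]]; rewrite dE /ind => dy ncy; split; first by case.
    move: dy; rewrite memNset; last by move=> /subset_closure.
    rewrite subr0 -normrN => dy; apply: le_trans (ler_norm _); lra.
Qed.

(** By induction, density finds a boundary point in the current [W], and shrinking [W] keeps the
    earlier bounds. As [W] misses the boundaries already treated, the index found is new. *)
Lemma many_big (L : I -> twist R u) : (forall k, L k (inr k) = 1) ->
  forall n, exists (s : seq I) (W : set K),
    [/\ uniq s, size s = n, open W, W !=set0 &
      forall y k, W y -> k \in s ->
        ~ boundary (u k) y /\ 3^-1 <= `|L k (inl y)|].
Proof.
move=> L1; elim=> [|n [s [W [us sn oW W0 sW]]]].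
  by exists [::], setT; split=> //; exact: openT.
have [x [Wx [k _ xk]]] := du W0 oW.
have ks : k \notin s by apply/negP => /(sW _ _ Wx)[].
have [W' [oW' W'0 W'W W'k]] := big_on_open (L1 k) xk oW Wx.
exists (k :: s), W'; split=> //=; first by rewrite ks.
  by rewrite sn.
by move=> y j W'y; rewrite inE => /orP[/eqP->|js]; [exact: W'k|exact: sW (W'W _ _) js].
Qed.

Lemma twist_nontrivial : ~ @trivial_sequence R _ _ incl.
Proof.
move=> [r [[M rM] rK]].
have /choice[e eE] k : exists z : twist R u,
    forall j, z (inr j) = if j \in [:: k] then 1 else 0.
  have [|||z _ zE] := @finite_lift R K I u nK ou uinj chainu [:: k] (fun=> 1) 1 => //.
    by move=> j _; rewrite normr1.
  by exists z.
(* [P] kills the range of [incl], which is the kernel of [proj]. So [P z] depends only on [proj z],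
   and [P] picks lifts linearly and boundedly. *)
pose P z := z - incl (r z).
have projP z : proj (P z) = proj z by apply/val_inj/funext => k; exact: subr0.
have P_eq0 z : proj z = 0 -> P z = 0.
  move=> pz; have : kernel proj z by [].
  rewrite (@twist_kernel_proj R K I u cK) => -[f _ <-].
  by rewrite /P (_ : r (incl f) = f) ?subrr// -[RHS]/(idfun f) -rK.
have P0 : P 0 = 0 by rewrite /P !linear0 addr0.
have PD : {morph P : y z / y + z}.
  by move=> y z; rewrite /P !linearD addrACA.
have PZ a z : P (a *: z) = a *: P z by rewrite /P scalerBr linearZ linearZ.
have PN z : P (- z) = - P z by rewrite -scaleN1r PZ scaleN1r.
pose L k := P (e k).
have Linr k j : L k (inr j) = if j == k then 1 else 0.
  by rewrite -[L k (inr j)]/(proj (P (e k)) j) projP -[LHS]/(e k (inr j)) eE inE.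
(* With [n] terms of size at least 1/3, the sum will exceed the bound [1 + |M|] for [P] on the unit
   ball. *)
have [n Mn] : exists n, 3 * (1 + `|M|) < n%:R :> R.
  by exists (Num.bound (3 * (1 + `|M|))); rewrite archi_boundP// mulr_ge0// addr_ge0.
have [|s [W [us sn oW [y Wy] sW]]] := @many_big L _ n.
  by move=> k; rewrite Linr eqxx.
(* These signs prevent cancellation at [y], while the lift [z] of [c] keeps norm at most 1 however
   large [n] is. *)
pose c k := Num.sg (L k (inl y)).
have [|||z z1 zE] := @finite_lift R K I u nK ou uinj chainu s c 1 => //.
  by move=> k _; rewrite /c normr_sg lern1 leq_b1.
have sumE (F : I -> twist R u) t : (\sum_(k <- s) F k) t = \sum_(k <- s) F k t.
  exact: (big_morph (fun w : twist R u => w t)).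
(* [z] and the combination of the [e k] have the same projection, hence the same image under [P]. *)
have PzE : P z = \sum_(k <- s) c k *: L k.
  apply/eqP; rewrite -subr_eq0; apply/eqP.
  have w0 : P (z - \sum_(k <- s) c k *: e k) = 0.
    apply: P_eq0; apply/val_inj/funext => k.
    rewrite -[LHS]/(z (inr k) - (\sum_(k <- s) c k *: e k) (inr k)) sumE zE.
    have -> : \sum_(j <- s) (c j *: e j) (inr k) =
        \sum_(j <- s) c j * (if k == j then 1 else 0).
      apply: eq_bigr => j _.
      by rewrite -[LHS]/(c j * e j (inr k)) eE inE.
    case: ifPn => ks; last first.
      rewrite big_seq big1 ?subrr// => j js; case: eqP => [kj|]; last by rewrite mulr0.
      by rewrite kj js in ks.
    rewrite (bigD1_seq k)//= eqxx mulr1 big1 ?addr0 ?subrr// => j jk.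
    by rewrite eq_sym (negbTE jk) mulr0.
  rewrite -[RHS]w0 PD PN (big_morph P PD P0); congr (_ - _).
  by apply: eq_bigr => k _; exact: esym (PZ _ _).
have : `|P z (inl y)| <= 1 + `|M|.
  rewrite -[P z _]/(z (inl y) - r z y) (le_trans (ler_normB _ _))// lerD//.
    exact: le_trans (twist_ge _ _) z1.
  apply: le_trans (supnorm_ge _ (Cspace_bounded (r z))) _.
  rewrite (le_trans (rM z))// (le_trans (ler_wpM2r _ (ler_norm M)))//.
  by rewrite ler_piMr.
apply/negP; rewrite -ltNge.
have -> : P z (inl y) = \sum_(k <- s) `|L k (inl y)|.
  rewrite PzE sumE; apply: eq_bigr => k _.
  by rewrite -[LHS]/(c k * L k (inl y)) /c -normrEsg.
apply: lt_le_trans (ler_norm _).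
apply: (@lt_le_trans _ _ (\sum_(k <- s) 3^-1)).
  rewrite big_const_seq count_predT sn iter_addr addr0 -mulr_natl; lra.
rewrite big_seq [leRHS]big_seq; apply: ler_sum => k ks.
by have [] := sW _ _ Wy ks.
Qed.
End tunnel.

Theorem theorem3p6 (R : realType) (K : topologicalType)
    (neK : [set: K] !=set0) (cK : compact [set: K]) (hK : hausdorff_space K)
    (kappa : Type) (F : set (set K)) (tF : regular_tunnel F)
    (cardF : F #= [set: kappa]) :
  exists (Z : completeNormedModType R)
         (i : {linear Cspace R cK -> Z}) (p : {linear Z -> c0 R kappa}),
    short_exact_sequence i p /\ ~ trivial_sequence i.
Proof.
have /card_set_bijP[u [uF uinj uonto]] := card_esym cardF.
move: tF => [[[oF chainF] dF] rF].
have Fu k : F (u k) by exact: uF.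
have ou k : open (u k) by exact: oF.
have inju : injective u by move=> j k; apply: uinj; rewrite inE.
have chainu j k : open_le (u j) (u k) \/ open_le (u k) (u j) by exact: chainF.
(* [{classic kappa}] supplies the equality test on indices needed for the finite sums. *)
exists (twist R (u : {classic kappa} -> set K)), (@twist_incl R K _ u cK),
  (@twist_proj R K _ u).
split; first exact: twist_exact.
apply: twist_nontrivial => //; last by move=> k; exact: rF.
move=> W W0 oW; have [x [Wx [U FU Ux]]] := dF W W0 oW.
by have [k _ kU] := uonto _ FU; exists x; split=> //; exists k; rewrite ?kU.
Qed.
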